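(* Let $\sigma$ be a permutation of $\{1,\dots,b\}$, let $n\ge1$, and let $k$ be an integer with $b-L(\sigma)\le k\le b$. Then there is a bijection between edge-labeled multi-digraphs without loops having $n$ arcs (labeled $1,\dots,n$) on $k$ vertices, and juggling card sequences $A$ of length $n$ using cards $C_S$ with $|S|=2$ (two balls caught and thrown at a time) in which a total of exactly $k$ distinct balls are thrown and with $\pi_A=\sigma$.
   Context: There are $b$ balls on levels $1,\dots,b$. For an ordered pair $S=(s_1,s_2)$ of distinct elements of $[b]$, the card $C_S$ induces the permutation $\pi_{C_S}$ of $[b]$ with $\pi_{C_S}(1)=s_1$, $\pi_{C_S}(2)=s_2$, and $\pi_{C_S}$ restricted to $\{3,\dots,b\}$ the order-preserving bijection onto $[b]\setminus\{s_1,s_2\}$; the balls thrown at the card are those at left levels $1$ and $2$. For $A=C_{S_1}\cdots C_{S_n}$, starting with ball $j$ at level $j$ and passing through the cards left to right, $\pi_A(j)$ is the final level of ball $j$, i.e. $\pi_A=\pi_{C_{S_n}}\circ\cdots\circ\pi_{C_{S_1}}$. For a permutation $\sigma$ of $[b]$, $L(\sigma)$ is the largest $\ell$ with $\sigma(b-\ell+1)<\cdots<\sigma(b)$. The digraphs are counted with unlabeled vertices (up to isomorphism preserving arc labels and directions), with distinct labels $1,\dots,n$ on the arcs, parallel arcs allowed, no loops, and every vertex incident to at least one arc. *)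

(* Defs.v *)
From mathcomp Require Import all_boot all_fingroup.
Set Implicit Arguments.
Unset Strict Implicit.
Unset Printing Implicit Defensive.

(* Levels, balls, cards of a sequence, vertices and arc labels are numbered from
   0, in 'I_b, 'I_n and 'I_k, instead of from 1. *)

(** * Juggling cards *)

(* The card C_S for S = (s_1, s_2). *)
Definition jcard (b : nat) := {S : 'I_b * 'I_b | S.1 != S.2}.

(* Right levels of a card, listed by left level: s_1, s_2, and then the
   remaining levels in increasing order (enum 'I_b is increasing). *)
Definition jcard_levels (b : nat) (C : jcard b) : seq 'I_b :=
  let: (s1, s2) := val C in
  [:: s1, s2 & [seq x <- enum 'I_b | x \notin [:: s1; s2]]].

Lemma jcard_levels_uniq b (C : jcard b) : uniq (jcard_levels C).
Proof.
case: C => -[s1 s2] /= ne; rewrite /jcard_levels /= filter_uniq ?enum_uniq //.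
by rewrite !inE negb_or !mem_filter !inE !eqxx orbT /= ne.
Qed.

Lemma size_jcard_levels b (C : jcard b) : size (jcard_levels C) = b.
Proof.
have/card_uniqP <- := jcard_levels_uniq C.
rewrite -[RHS]card_ord; apply: eq_card => x.
case: C => -[s1 s2] ne; rewrite /jcard_levels /= !inE mem_filter mem_enum !inE.
by case: (x == s1); case: (x == s2).
Qed.

Definition jcard_fun (b : nat) (C : jcard b) (i : 'I_b) : 'I_b :=
  nth i (jcard_levels C) i.

Lemma jcard_fun_inj b (C : jcard b) : injective (jcard_fun C).
Proof.
move=> i j; rewrite /jcard_fun (set_nth_default j) ?size_jcard_levels // => eij.
apply/val_inj/eqP; move/eqP: eij.
by rewrite nth_uniq ?size_jcard_levels ?jcard_levels_uniq.
Qed.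

Definition jcard_perm (b : nat) (C : jcard b) : 'S_b := perm (@jcard_fun_inj b C).

Lemma jcard_perm_first b (C : jcard b) (i : 'I_b) :
  i = 0 :> nat -> jcard_perm C i = (val C).1.
Proof. by case: C => -[s1 s2] ne i0; rewrite permE /jcard_fun i0. Qed.

Lemma jcard_perm_second b (C : jcard b) (i : 'I_b) :
  i = 1 :> nat -> jcard_perm C i = (val C).2.
Proof. by case: C => -[s1 s2] ne i1; rewrite permE /jcard_fun i1. Qed.

Lemma jcard_perm_mono b (C : jcard b) (i j : 'I_b) :
  1 < i -> i < j -> jcard_perm C i < jcard_perm C j.
Proof.
move=> i1 ij; rewrite !permE /jcard_fun.
rewrite (set_nth_default j) ?size_jcard_levels //.
have: j < size (jcard_levels C) by rewrite size_jcard_levels.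
case: C => -[s1 s2] ne; rewrite /jcard_levels /=.
case: i i1 ij => -[|[|i]] //= hi _; case: j => -[|[|j]] //= hj ij.
set d := Ordinal hj; set s := filter _ _ => js.
have srt : sorted (fun x y : 'I_b => x < y) s.
  apply: sorted_filter; first by move=> y x z; apply: ltn_trans.
  rewrite -(@sorted_map _ _ val ltn) val_enum_ord.
  exact: iota_ltn_sorted.
apply: (sorted_ltn_nth _ d srt) => //; first by move=> y x z; apply: ltn_trans.
by rewrite inE; apply: (ltn_trans ij js).
Qed.

(** * Card sequences *)

(* The product of permutations composes from left to right:
   (s * t) x = t (s x). *)
Definition seq_perm (b : nat) (A : seq (jcard b)) : 'S_b :=
  (\prod_(C <- A) jcard_perm C)%g.

(* seq_perm (take i A) j is the level of ball j when it reaches the card of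
   index i; the balls at the two lowest levels are the ones thrown there. *)
Definition thrown (b n : nat) (A : n.-tuple (jcard b)) : {set 'I_b} :=
  [set j | [exists i : 'I_n, seq_perm (take i A) j < 2]].

Definition jcard_seqs (b n k : nat) (sigma : 'S_b) : {set n.-tuple (jcard b)} :=
  [set A : n.-tuple (jcard b) | #|thrown A| == k & seq_perm A == sigma].

Definition L (b : nat) (sigma : 'S_b) : nat :=
  \max_(l < b.+1 | [forall i : 'I_b, forall j : 'I_b,
                      (b - l <= i < j) ==> (sigma i < sigma j)]) l.

(** * Edge-labeled multi-digraphs *)

(* An arc-labeled multi-digraph on the vertex set 'I_k: each label i is sent
   to the pair (tail, head) of the arc labeled i. *)
Definition digraph (n k : nat) := {ffun 'I_n -> 'I_k * 'I_k}.

Definition loopless (n k : nat) (G : digraph n k) : bool :=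
  [forall i, (G i).1 != (G i).2].

Definition no_isolated (n k : nat) (G : digraph n k) : bool :=
  [forall v, exists i, (v == (G i).1) || (v == (G i).2)].

Definition digraph_iso (n k : nat) : rel (digraph n k) := fun G H =>
  [exists s : 'S_k, forall i, H i == (s (G i).1, s (G i).2)].

Lemma digraph_isoP n k (G H : digraph n k) :
  reflect (exists s : 'S_k, forall i, H i = (s (G i).1, s (G i).2))
          (digraph_iso G H).
Proof.
apply: (iffP existsP) => -[s sGH]; exists s.
  by move=> i; apply/eqP; apply: (forallP sGH).
by apply/forallP => i; apply/eqP.
Qed.

Lemma digraph_iso_equiv n k : equivalence_rel (@digraph_iso n k).
Proof.
have isoR : reflexive (@digraph_iso n k).
  by move=> G; apply/digraph_isoP; exists 1%g => i; rewrite !perm1; case: (G i).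
have isoS G H : digraph_iso G H -> digraph_iso H G.
  move/digraph_isoP=> [s sGH]; apply/digraph_isoP; exists s^-1%g => i.
  by rewrite sGH /= !permK; case: (G i).
have isoT : transitive (@digraph_iso n k).
  move=> H G K /digraph_isoP[s sGH] /digraph_isoP[t tHK].
  by apply/digraph_isoP; exists (s * t)%g => i; rewrite tHK sGH /= !permM.
apply/equivalence_relP; split=> // G H GH K; apply/idP/idP; last exact: isoT.
by apply: isoT; apply: isoS.
Qed.

(* Digraphs with unlabeled vertices, as isomorphism classes. *)
Definition digraph_classes (n k : nat) : {set {set digraph n k}} :=
  equivalence_partition (@digraph_iso n k)
    [set G : digraph n k | loopless G && no_isolated G].

(* Main.v *)
Require Import Defs.
From mathcomp Require Import all_boot all_fingroup.

(* Read a card sequence backwards from the final arrangement sigma: undoing a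
   card moves the two balls thrown there to the two lowest levels and keeps the
   order of the others.  So any sequence of n ordered pairs of distinct balls
   comes from exactly one card sequence, and the initial arrangement has the
   thrown balls sorted by first appearance, followed by the other balls in the
   order given by sigma.  This arrangement is the identity if and only if the
   thrown balls are the first k, numbered by first appearance, and sigma
   increases on the other ones, which k >= b - L(sigma) guarantees.  Finally,
   every arc-labeled digraph has a unique numbering of its vertices by first
   appearance. *)

Set Implicit Arguments.
Unset Strict Implicit.
Unset Printing Implicit Defensive.

(** * Order-preserving permutations, ranks and initial segments *)

(** [enum 'I_b] and its image under [s] are strictly sorted lists with the same elements, hence
    equal. *)
Lemma perm_homo_id b (s : 'S_b) : {homo s : x y / x < y} -> s = 1%g.
Proof.
move=> hs; pose r := fun x y : 'I_b => x < y.
have tr : transitive r by move=> y x z; apply: ltn_trans.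
have ir : irreflexive r by move=> x; apply: ltnn.
have srt : sorted r (enum 'I_b).
  by rewrite -(@sorted_map _ _ val ltn) val_enum_ord iota_ltn_sorted.
have srt' : sorted r (map s (enum 'I_b)) by apply: (homo_sorted (e := r)).
have E : map s (enum 'I_b) = map id (enum 'I_b).
  rewrite map_id; apply: (irr_sorted_eq tr ir) => // x.
  by rewrite mem_enum -[x in LHS](permKV s) map_f ?mem_enum.
apply/permP => x; rewrite perm1.
by move/eq_in_map: E => ->; rewrite ?mem_enum.
Qed.

(** The witness sends [x] to its rank, the number of [y] with [f y < f x]. *)
Lemma perm_rank k (f : 'I_k -> nat) : injective f ->
  exists s : 'S_k, forall x y, (s x < s y) = (f x < f y).
Proof.
move=> fI; pose B x := [set y | f y < f x].
have Blt x : #|B x| < k.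
  rewrite -[k in _ < k]card_ord -cardsT; apply: proper_card.
  by apply/properP; split; [exact: subsetT | exists x; rewrite !inE ?ltnn].
have [r rlt] : exists r : 'I_k -> 'I_k, forall x y, f x < f y -> r x < r y.
  exists (fun x => Ordinal (Blt x)) => x y lt_xy /=.
  apply: proper_card; apply/properP; split.
    by apply/subsetP => z; rewrite !inE => /ltn_trans; apply.
  by exists x; rewrite inE ?ltnn.
have rE x y : (r x < r y) = (f x < f y).
  case: (ltngtP (f x) (f y)) => [/rlt-> // | /rlt lt_yx | /fI ->].
    by apply/negbTE; rewrite -leqNgt ltnW.
  by rewrite ltnn.
have rI : injective r.
  move=> x y rxy; apply: fI; apply/eqP; rewrite eqn_leq leqNgt (leqNgt (f y)).
  by rewrite -!rE rxy ltnn.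
by exists (perm rI) => x y; rewrite !permE rE.
Qed.

Lemma widen_ord_inj k b (kb : k <= b) : injective (widen_ord kb).
Proof. by move=> x y /(congr1 val) /= /val_inj. Qed.

Lemma card_ord_lt b k : k <= b -> #|[set x : 'I_b | x < k]| = k.
Proof.
move=> kb; rewrite -[RHS]card_ord -(card_imset _ (@widen_ord_inj _ _ kb)).
apply: eq_card => x; rewrite inE; apply/idP/imsetP => [xk | [y _ ->] /=].
  by exists (Ordinal xk) => //; apply: val_inj.
exact: ltn_ord.
Qed.

(** All [y <= x] lie in [W] whenever [x] does, so [x.+1 <= #|W|]; comparing cardinalities turns this
    inclusion into equality. *)
Lemma initial_set b (W : {set 'I_b}) :
  (forall x y, x \in W -> y \notin W -> x < y) -> W = [set x : 'I_b | x < #|W|].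
Proof.
move=> down; have Wb : #|W| <= b by rewrite -[X in _ <= X]card_ord max_card.
apply/eqP; rewrite eqEcard card_ord_lt // leqnn andbT.
apply/subsetP => x xW; rewrite inE.
rewrite -(@card_ord_lt b x.+1) //; apply: subset_leq_card.
apply/subsetP => y; rewrite inE ltnS; apply: contraTT => yW.
by rewrite -ltnNge down.
Qed.

Lemma L_increasing b (sigma : 'S_b) (x y : 'I_b) :
  b - L sigma <= x -> x < y -> sigma x < sigma y.
Proof.
pose Q l := forall i j : 'I_b, b - l <= i -> i < j -> sigma i < sigma j.
suff: Q (L sigma) by apply.
(* [Q] is vacuous at 0 and passes to maxima, so it holds at the maximum defining [L]. *)
rewrite /L; apply: (big_ind Q).
- by move=> i j; rewrite subn0 leqNgt ltn_ord.
- by move=> l m Ql Qm; case: (leqP l m).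
- move=> l /forallP Pl i j li ij.
  by move: (Pl i) => /forallP/(_ j)/implyP; apply; rewrite li ij.
Qed.

(** * Arcs and cards *)

(** In this order, [index] measures the time of first appearance; an absent element gets the size of
    the list. *)
Definition endpoints (T : Type) (l : seq (T * T)) : seq T :=
  flatten [seq [:: e.1; e.2] | e <- l].

Lemma endpoints_map (T U : Type) (f : T -> U) (l : seq (T * T)) :
  endpoints [seq (f e.1, f e.2) | e <- l] = map f (endpoints l).
Proof. by elim: l => //= e l IH; rewrite -IH. Qed.

Lemma mem_endpoints (T : eqType) (x : T) (l : seq (T * T)) :
  (x \in endpoints l) = has (fun e => (x == e.1) || (x == e.2)) l.
Proof. by elim: l => //= e l IH; rewrite !inE orbA -IH. Qed.

Lemma card_apply_subproof b (t : 'S_b) (C : jcard b) :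
  t (val C).1 != t (val C).2.
Proof. by rewrite (inj_eq perm_inj) (valP C). Qed.

Definition card_apply b (t : 'S_b) (C : jcard b) : jcard b :=
  exist (fun S : 'I_b * 'I_b => S.1 != S.2) (t (val C).1, t (val C).2)
        (card_apply_subproof t C).

Lemma card_applyK b (t : 'S_b) : cancel (card_apply t) (card_apply t^-1).
Proof. by case=> -[u v] ne; apply: val_inj; rewrite /= !permK. Qed.

Lemma card_applyKV b (t : 'S_b) : cancel (card_apply t^-1) (card_apply t).
Proof. by move=> C; rewrite -{1}[t]invgK card_applyK. Qed.

(* The arrangement before the cards A, when the one after them is sigma. *)
Definition before b (sigma : 'S_b) (A : seq (jcard b)) : 'S_b :=
  (sigma * (seq_perm A)^-1)%g.

Lemma before_nil b (sigma : 'S_b) : before sigma [::] = sigma.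
Proof. by rewrite /before /seq_perm big_nil invg1 mulg1. Qed.

Lemma before_cons b (sigma : 'S_b) C A :
  before sigma (C :: A) = (before sigma A * (jcard_perm C)^-1)%g.
Proof. by rewrite /before /seq_perm big_cons invMg mulgA. Qed.

(* The arc of a card is the pair of balls thrown there; arcs are encoded in
   jcard b because both are pairs of distinct elements of 'I_b. *)
Fixpoint arcs b (sigma : 'S_b) (A : seq (jcard b)) : seq (jcard b) :=
  if A is C :: A' then
    card_apply (before sigma A')^-1 C :: arcs sigma A' else [::].

(** Decoding starts from the last card: the arrangement just after a card depends only on [sigma]
    and the later cards. *)
Fixpoint cards b (sigma : 'S_b) (l : seq (jcard b)) : seq (jcard b) :=
  if l is e :: l' then
    card_apply (before sigma (cards sigma l')) e :: cards sigma l' else [::].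

Lemma arcsK b (sigma : 'S_b) : cancel (arcs sigma) (cards sigma).
Proof. by elim=> //= C A ->; rewrite card_applyKV. Qed.

Lemma cardsK b (sigma : 'S_b) : cancel (cards sigma) (arcs sigma).
Proof. by elim=> //= e l ->; rewrite card_applyK. Qed.

Lemma size_arcs b (sigma : 'S_b) A : size (arcs sigma A) = size A.
Proof. by elim: A => //= C A ->. Qed.

Lemma size_cards b (sigma : 'S_b) l : size (cards sigma l) = size l.
Proof. by elim: l => //= e l ->. Qed.

Section UndoCard.

Variables (b : nat) (t : 'S_b) (C : jcard b).
(** Here [t] and [t'] are the arrangements after and before the card [C], and [u], [v] are the balls
    thrown at it. *)
Let u := t^-1%g (val C).1.
Let v := t^-1%g (val C).2.
Let t' := (t * (jcard_perm C)^-1)%g.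

Lemma undo_card_first : t' u = 0 :> nat.
Proof.
rewrite /t' permM /u permKV.
have b0 : 0 < b by apply: leq_ltn_trans (ltn_ord (val C).1).
by rewrite -(@jcard_perm_first b C (Ordinal b0)) ?permK.
Qed.

Lemma undo_card_second : t' v = 1 :> nat.
Proof.
rewrite /t' permM /v permKV.
have b1 : 1 < b.
  case: C => -[[i hi] [j hj]] /=; rewrite -val_eqE /= => ne.
  by case: b i j hi hj ne => [|[|?]] // [|i] [|j].
by rewrite -(@jcard_perm_second b C (Ordinal b1)) ?permK.
Qed.

Lemma undo_card_lt2 x : (t' x < 2) = (x == u) || (x == v).
Proof.
have E z : (x == z) = (t' x == t' z :> nat) by rewrite val_eqE (inj_eq perm_inj).
by rewrite !E undo_card_first undo_card_second; case: (nat_of_ord _) => [|[|]].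
Qed.

(** Before the card both balls are at levels at least 2, where the card is increasing. *)
Lemma undo_card_mono x y : x != u -> x != v -> y != u -> y != v ->
  (t' x < t' y) = (t x < t y).
Proof.
move=> xu xv yu yv.
have x2 : 1 < t' x by rewrite ltnNge -ltnS undo_card_lt2 negb_or xu.
have y2 : 1 < t' y by rewrite ltnNge -ltnS undo_card_lt2 negb_or yu.
have tE z : t z = jcard_perm C (t' z) by rewrite /t' permM permKV.
rewrite !tE; case: (ltngtP (t' x) (t' y)) => [lt_xy|lt_yx|/val_inj->].
- by rewrite jcard_perm_mono.
- by apply/esym/negbTE; rewrite -leqNgt ltnW // jcard_perm_mono.
- by rewrite ltnn.
Qed.

End UndoCard.

(** Induction from the last card backwards. Putting [C] in front places [u], [v] at the head of the
    list and at levels 0 and 1; all other balls keep their order, and their indices all grow by two.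
    Distinct balls tie in [index] only when neither is thrown, and then [sigma] decides. *)
Lemma before_ltE b (sigma : 'S_b) A (w := endpoints (map val (arcs sigma A)))
    x y :
  (before sigma A x < before sigma A y) =
  (index x w < index y w) || (index x w == index y w) && (sigma x < sigma y).
Proof.
rewrite {}/w; elim: A => [|C A IH] in x y *; first by rewrite before_nil.
rewrite before_cons /=; set t := before sigma A in IH *.
set u := t^-1%g _; set v := t^-1%g _.
have first := undo_card_first t C; have second := undo_card_second t C.
have lt2 z := undo_card_lt2 t C z; have mono := @undo_card_mono b t C.
rewrite /= -/u -/v in first second lt2 mono.
have uv : u == v = false.
  by rewrite /u /v (inj_eq perm_inj); apply: negbTE (valP C).
have ge2 z : z != u -> z != v -> 1 < (t * (jcard_perm C)^-1)%g z.
  by move=> zu zv; rewrite ltnNge -ltnS lt2 negb_or zu.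
rewrite (eq_sym u x) (eq_sym v x) (eq_sym u y) (eq_sym v y).
have [->|xu] := eqVneq x u.
  have [->|yu] := eqVneq y u; first by rewrite !ltnn.
  have [->|yv] := eqVneq y v; first by rewrite first second.
  by rewrite first (ltn_trans _ (ge2 _ yu yv)).
have [->|xv] := eqVneq x v.
  have [->|yu] := eqVneq y u; first by rewrite first second.
  have [->|yv] := eqVneq y v; first by rewrite !ltnn.
  by rewrite second (ge2 _ yu yv).
have [->|yu] := eqVneq y u; first by rewrite first.
have [->|yv] := eqVneq y v.
  by rewrite second ltnNge ltnW ?ge2.
by rewrite mono // IH.
Qed.

(** This links the backward reading to the forward levels in [thrown]: cancelling the suffix leaves
    the product over the prefix. *)
Lemma before_drop b (sigma : 'S_b) A i : seq_perm A = sigma ->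
  before sigma (drop i A) = seq_perm (take i A).
Proof.
move=> <-; rewrite /before -[in seq_perm A](cat_take_drop i A).
by rewrite /seq_perm big_cat /= mulgK.
Qed.

Lemma arcs_drop b (sigma : 'S_b) A i :
  arcs sigma (drop i A) = drop i (arcs sigma A).
Proof. by elim: A i => [|C A IH] [|i] //=. Qed.

Lemma thrownE b n (sigma : 'S_b) (A : n.-tuple (jcard b)) :
  seq_perm A = sigma ->
  thrown A = [set j | j \in endpoints (map val (arcs sigma A))].
Proof.
move=> sA; apply/setP => j; rewrite !inE mem_endpoints has_map.
(* The balls at the two lowest levels before card [i] are the ends of arc [i]. *)
have E i : i < n -> forall C0, (seq_perm (take i A) j < 2) =
    ((j == (val (nth C0 (arcs sigma A) i)).1)
     || (j == (val (nth C0 (arcs sigma A) i)).2)).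
  move=> ltin C0; rewrite -(before_drop i sA).
  have := nth_drop i C0 (arcs sigma A) 0; rewrite addn0 -arcs_drop => <-.
  case D: (drop i A) => [|C A'].
    by have := congr1 size D; rewrite size_drop size_tuple => /eqP;
       rewrite subn_eq0 leqNgt ltin.
  by rewrite before_cons undo_card_lt2.
apply/existsP/idP => [[i ti]|].
  have C0 := tnth A i.
  apply/(has_nthP C0); exists i; first by rewrite size_arcs size_tuple.
  by rewrite /= -E.
(* A default card for [nth] is available only for nonempty [A]; the empty sequence has no
   endpoints. *)
case: n A sA E => [|n] A sA E; first by rewrite tuple0.
have C0 := thead A.
case/(has_nthP C0) => i; rewrite size_arcs size_tuple => ltin ti.
by exists (Ordinal ltin); rewrite (E _ ltin C0).
Qed.

(** * Canonical numbering of the vertices *)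

Definition vertices n k (G : digraph n k) : seq 'I_k :=
  endpoints [seq G i | i <- enum 'I_n].

Lemma mem_vertices n k (G : digraph n k) : no_isolated G ->
  forall v, v \in vertices G.
Proof.
move=> /forallP iso v; rewrite mem_endpoints has_map.
have /existsP[i vi] := iso v.
by apply/hasP; exists i; rewrite ?mem_enum.
Qed.

Definition canonical n k (G : digraph n k) : bool :=
  [forall x : 'I_k, forall y : 'I_k,
    (x < y) ==> (index x (vertices G) < index y (vertices G))].

Lemma canonicalP n k (G : digraph n k) :
  reflect {homo index^~ (vertices G) : x y / x < y} (canonical G).
Proof.
apply: (iffP forallP) => [H x y|H x].
  by have /forallP/(_ y)/implyP := H x.
by apply/forallP => y; apply/implyP; apply: H.
Qed.

Definition canonical_digraphs n k : {set digraph n k} :=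
  [set G | [&& loopless G, no_isolated G & canonical G]].

Lemma vertices_iso n k (G H : digraph n k) (s : 'S_k) :
  (forall i, H i = (s (G i).1, s (G i).2)) -> vertices H = map s (vertices G).
Proof.
move=> sGH; rewrite /vertices -endpoints_map; congr endpoints.
by rewrite -[RHS]map_comp; apply: eq_map => i; rewrite sGH.
Qed.

Lemma iso_loopless n k (G H : digraph n k) :
  digraph_iso G H -> loopless G -> loopless H.
Proof.
move=> /digraph_isoP[s sGH] /forallP lG; apply/forallP => i.
by rewrite sGH (inj_eq perm_inj).
Qed.

Lemma iso_no_isolated n k (G H : digraph n k) :
  digraph_iso G H -> no_isolated G -> no_isolated H.
Proof.
move=> /digraph_isoP[s sGH] /forallP lG; apply/forallP => v.
have /existsP[i vi] := lG (s^-1%g v); apply/existsP; exists i.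
by rewrite sGH /= -{1 2}[v](permKV s) !(inj_eq perm_inj).
Qed.

(** Each vertex is renamed to its rank by first appearance; [index] is injective because every
    vertex occurs in the list. *)
Lemma canonical_exists n k (G : digraph n k) : no_isolated G ->
  exists2 H, digraph_iso G H & canonical H.
Proof.
move=> isoG.
have idxI : injective (index^~ (vertices G)).
  move=> x y exy; rewrite -(nth_index x (mem_vertices isoG x)) exy.
  by rewrite nth_index ?mem_vertices.
have [s sE] := perm_rank idxI.
pose H : digraph n k := [ffun i => (s (G i).1, s (G i).2)].
have HE i : H i = (s (G i).1, s (G i).2) by rewrite ffunE.
exists H; first by apply/digraph_isoP; exists s.
apply/canonicalP => x y; rewrite (vertices_iso HE) -[x](permKV s) -[y](permKV s).
by rewrite !(index_map (@perm_inj _ s)) sE.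
Qed.

(** An isomorphism preserves the time of first appearance, so between canonical digraphs it is
    increasing, hence the identity. *)
Lemma canonical_unique n k (G H : digraph n k) : no_isolated G ->
  canonical G -> canonical H -> digraph_iso G H -> G = H.
Proof.
move=> isoG /canonicalP cG /canonicalP cH /digraph_isoP[s sGH].
suff s1 : s = 1%g by apply/ffunP => i; rewrite sGH s1 !perm1; case: (G i).
apply: perm_homo_id => x y lt_xy.
have idx z : index (s z) (vertices H) = index z (vertices G).
  by rewrite (vertices_iso sGH) (index_map (@perm_inj _ s)).
case: (ltngtP (s x) (s y)) => // [/cH|/val_inj/perm_inj eq_xy].
  by rewrite !idx ltnNge ltnW ?cG.
by rewrite eq_xy ltnn in lt_xy.
Qed.

Lemma card_digraph_classes n k :
  #|digraph_classes n k| = #|canonical_digraphs n k|.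
Proof.
set D := [set G : digraph n k | loopless G && no_isolated G].
have eqR : {in D & &, equivalence_rel (@digraph_iso n k)}.
  by move=> x y z _ _ _; apply: digraph_iso_equiv.
have part := equivalence_partitionP eqR.
(* The canonical digraphs form a transversal of the isomorphism classes. *)
apply/esym/(@card_transversal _ _ _ D)/and3P; split => //.
  by apply/subsetP => G; rewrite !inE => /and3P[-> ->].
apply/forall_inP => B /imsetP[G]; rewrite inE => /andP[lG iG] ->.
have [H GH cH] := canonical_exists iG.
have iH := iso_no_isolated GH iG; have lH := iso_loopless GH lG.
apply/cards1P; exists H; apply/setP => K; rewrite !inE.
apply/idP/eqP => [|->]; last by rewrite lH iH cH GH.
case/andP => /and3P[_ iK cK] /andP[_ GK].
apply: (canonical_unique iK) => //.
have /equivalence_relP[iR iT] := @digraph_iso_equiv n k.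
by rewrite -(iT _ _ GK).
Qed.

(** * Card sequences of canonical digraphs *)

Lemma arc_tuple_subproof b n (sigma : 'S_b) (A : n.-tuple (jcard b)) :
  size (map val (arcs sigma A)) == n.
Proof. by rewrite size_map size_arcs size_tuple. Qed.

(** Card sequences and digraphs are both embedded in [n.-tuple ('I_b * 'I_b)], where their images
    can be compared. *)
Definition arc_tuple b n (sigma : 'S_b) (A : n.-tuple (jcard b)) :
  n.-tuple ('I_b * 'I_b) := Tuple (arc_tuple_subproof sigma A).

Lemma arc_tuple_inj b n (sigma : 'S_b) : injective (@arc_tuple b n sigma).
Proof.
move=> A B /(congr1 val) /= /(inj_map val_inj) /(can_inj (@arcsK b sigma)).
exact: val_inj.
Qed.

Definition widen_arc b k (kb : k <= b) (e : 'I_k * 'I_k) : 'I_b * 'I_b :=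
  (widen_ord kb e.1, widen_ord kb e.2).

Lemma widen_arc_inj b k (kb : k <= b) : injective (widen_arc kb).
Proof.
by move=> [? ?] [? ?] [e1 e2]; congr pair; apply: val_inj.
Qed.

Definition digraph_tuple b n k (kb : k <= b) (G : digraph n k) :
  n.-tuple ('I_b * 'I_b) := [tuple widen_arc kb (G i) | i < n].

Lemma digraph_tuple_inj b n k (kb : k <= b) :
  injective (@digraph_tuple b n k kb).
Proof.
move=> G H /(congr1 (fun t => tnth t)) eGH; apply/ffunP => i.
by apply: (@widen_arc_inj _ _ kb); have := congr1 (@^~ i) eGH; rewrite !tnth_mktuple.
Qed.

Lemma endpoints_digraph_tuple b n k (kb : k <= b) (G : digraph n k) :
  endpoints (digraph_tuple kb G) = map (widen_ord kb) (vertices G).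
Proof.
by rewrite /vertices -endpoints_map; congr endpoints; rewrite -[RHS]map_comp.
Qed.

Section CanonicalSequences.

Variables (b n k : nat) (sigma : 'S_b) (kb : k <= b).

Let idx (G : digraph n k) x :
  index (widen_ord kb x) (endpoints (digraph_tuple kb G)) = index x (vertices G).
Proof.
by rewrite endpoints_digraph_tuple (index_map (@widen_ord_inj _ _ kb)).
Qed.

Lemma digraph_of_seq (A : n.-tuple (jcard b)) : A \in jcard_seqs n k sigma ->
  exists2 G, G \in canonical_digraphs n k & arc_tuple sigma A = digraph_tuple kb G.
Proof.
rewrite inE => /andP[/eqP cardA /eqP sA].
have before1 : before sigma A = 1%g by rewrite /before sA mulgV.
have ordE x y := before_ltE sigma A x y.
rewrite before1 in ordE.
move: cardA; rewrite (thrownE sA).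
set w := endpoints _ in ordE *; set W := [set j | j \in w] => cardW.
(* The initial arrangement is the identity, so every thrown ball precedes every unthrown one, whose
   index is the size of [w]. *)
have WE : W = [set x : 'I_b | x < k].
  rewrite -cardW; apply: initial_set => x y; rewrite !inE => xw yw.
  have := ordE x y; rewrite !perm1 => ->.
  by rewrite (memNindex yw) index_mem xw.
have wk x : x \in w = (x < k).
  by have /setP/(_ x) := WE; rewrite !inE.
pose e i := tnth (arc_tuple sigma A) i.
have ew i : ((e i).1 \in w) && ((e i).2 \in w).
  have ei : e i \in map val (arcs sigma A) by apply: mem_tnth.
  by rewrite !mem_endpoints; apply/andP; split; apply/hasP; exists (e i);
     rewrite ?eqxx ?orbT.
have e1 i : (e i).1 < k by rewrite -wk; case/andP: (ew i).
have e2 i : (e i).2 < k by rewrite -wk; case/andP: (ew i).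
pose G : digraph n k := [ffun i => (Ordinal (e1 i), Ordinal (e2 i))].
have GE : arc_tuple sigma A = digraph_tuple kb G.
  apply: eq_from_tnth => i; rewrite tnth_mktuple ffunE -/(e i) /widen_arc.
  by rewrite [LHS]surjective_pairing; congr pair; apply: val_inj.
have wE : w = endpoints (digraph_tuple kb G) by rewrite -GE.
exists G => //; rewrite inE; apply/and3P; split.
- apply/forallP => i; rewrite ffunE /= -val_eqE /=.
  have /mapP[C _ eC] : e i \in map val (arcs sigma A) by apply: mem_tnth.
  by have := valP C; rewrite -eC -val_eqE.
- apply/forallP => v.
  have : widen_ord kb v \in w by rewrite wk /= ltn_ord.
  rewrite wE endpoints_digraph_tuple (mem_map (@widen_ord_inj _ _ kb)).
  rewrite mem_endpoints has_map => /hasP[i _ vi].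
  by apply/existsP; exists i.
- apply/canonicalP => x y lt_xy; rewrite -!idx -wE.
  have := ordE (widen_ord kb x) (widen_ord kb y); rewrite !perm1 /= lt_xy.
  (* A tie is impossible: both balls occur in [w], so equal indices would make them equal. *)
  case/esym/orP => // /andP[/eqP eq_xy _].
  suff /(congr1 val) /= eq : widen_ord kb x = widen_ord kb y.
    by rewrite eq ltnn in lt_xy.
  have inw z : widen_ord kb z \in w by rewrite wk /= ltn_ord.
  by rewrite -(nth_index (widen_ord kb x) (inw x)) eq_xy nth_index.
Qed.

(** The arcs, viewed as elements of [jcard b], are decoded by [cards]; what remains is that the
    initial arrangement is the identity. *)
Lemma seq_of_digraph (G : digraph n k) :
  b - L sigma <= k -> G \in canonical_digraphs n k ->
  exists2 A, A \in jcard_seqs n k sigma & arc_tuple sigma A = digraph_tuple kb G.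
Proof.
move=> Lk; rewrite inE => /and3P[/forallP lG iG /canonicalP cG].
have ne i : (widen_arc kb (G i)).1 != (widen_arc kb (G i)).2.
  exact: lG.
pose l := [tuple exist (fun S : 'I_b * 'I_b => S.1 != S.2) _ (ne i) | i < n].
have sz : size (cards sigma l) == n by rewrite size_cards size_tuple.
pose A : n.-tuple (jcard b) := Tuple sz.
have AE : arc_tuple sigma A = digraph_tuple kb G.
  by apply: val_inj; rewrite /= cardsK -map_comp; apply: eq_map.
have ordE x y := before_ltE sigma A x y.
have vE : map val (arcs sigma A) = digraph_tuple kb G by rewrite -AE.
rewrite vE in ordE; set w := endpoints _ in ordE.
have wE x : (x \in w) = (x < k).
  rewrite /w endpoints_digraph_tuple; apply/mapP/idP => [[y _ ->] /=|xk].
    exact: ltn_ord.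
  by exists (Ordinal xk); [exact: mem_vertices | exact: val_inj].
have b1 : before sigma A = 1%g.
  apply: perm_homo_id => x y lt_xy; rewrite ordE.
  (* If [y < k], canonicity orders both. If only [x < k], then [x] appears and [y] does not. If
     neither is below [k], the tie is decided by [sigma], which increases from [b - L sigma <= k]
     on. *)
  case: (ltnP y k) => [yk|ky].
    have xk := ltn_trans lt_xy yk.
    have /cG : Ordinal xk < Ordinal yk by [].
    rewrite -!idx -/w (_ : widen_ord _ _ = x); last exact: val_inj.
    by rewrite (_ : widen_ord _ _ = y) => [->|]; last exact: val_inj.
  have yw : y \notin w by rewrite wE -leqNgt.
  rewrite (memNindex yw) index_mem wE; case: (ltnP x k) => // kx.
  have xw : x \notin w by rewrite wE -leqNgt.
  by rewrite (memNindex xw) eqxx L_increasing // (leq_trans Lk).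
have sA : seq_perm A = sigma.
  by apply/eqP; rewrite eq_sym eq_mulgV1 -/(before sigma A) b1.
exists A => //; rewrite inE sA eqxx andbT (thrownE sA) vE -/w.
by rewrite -[X in _ == X](card_ord_lt kb); apply/eqP/eq_card => x; rewrite !inE wE.
Qed.

(** The two injections into tuples of pairs have the same image. *)
Lemma card_jcard_seqs : b - L sigma <= k ->
  #|jcard_seqs n k sigma| = #|canonical_digraphs n k|.
Proof.
move=> Lk; rewrite -(card_imset _ (@arc_tuple_inj b n sigma)).
rewrite -[RHS](card_imset _ (@digraph_tuple_inj b n k kb)).
apply: eq_card => t; apply/imsetP/imsetP => -[].
  by move=> A /digraph_of_seq[G cG ->] ->; exists G.
by move=> G /(seq_of_digraph Lk)[A cA <-] ->; exists A.
Qed.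

End CanonicalSequences.

(** * From equal cardinalities to a bijection *)

Lemma eq_card_bij (T U : finType) : #|T| = #|U| -> exists f : T -> U, bijective f.
Proof.
move=> eTU; exists (fun x => enum_val (cast_ord eTU (enum_rank x))).
exists (fun y => enum_val (cast_ord (esym eTU) (enum_rank y))) => x.
  by rewrite enum_valK cast_ordK enum_rankK.
by rewrite enum_valK cast_ordKV enum_rankK.
Qed.

Theorem theorem2p6 (b n k : nat) (sigma : 'S_b)
    (hn : 1 <= n) (hk : b - L sigma <= k <= b) :
  exists f : {D : {set digraph n k} | D \in digraph_classes n k} ->
             {A : n.-tuple (jcard b) | A \in jcard_seqs n k sigma},
    bijective f.
Proof.
case/andP: hk => Lk kb; apply: eq_card_bij.
by rewrite !card_sig card_digraph_classes (card_jcard_seqs _ kb Lk).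
Qed.
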